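(* Let $m\ge 2$, let $C\subseteq(\mathbb{Z}/m\mathbb{Z})^n$ be a linear $m$-ary code of length $n$ and let $C^\perp$ denote its dual. Then for $0\le q<1$ $$\Theta_{\Lambda_{A(C^\perp)}}^1(q)=\frac{(1-q^2)^n}{|C|}\,swe_C\!\left(y_0,y_1,\dots,y_{\lfloor\frac{m}{2}\rfloor}\right),$$ where $$y_k=\frac{1}{q^2-2q\cos\left(\frac{2 \pi k}{m}\right)+1}\quad\text{for all }k=0,1,\dots,\left\lfloor\tfrac{m}{2}\right\rfloor.$$
   Context: An $m$-ary linear code of length $n$ is a $\mathbb{Z}$-submodule $C$ of $(\mathbb{Z}/m\mathbb{Z})^n$; its dual is $C^\perp=\{y\in(\mathbb{Z}/m\mathbb{Z})^n: y\cdot x\equiv 0\pmod m\text{ for all }x\in C\}$. The Construction A lattice of a code $D\subseteq(\mathbb{Z}/m\mathbb{Z})^n$ is $\Lambda_{A(D)}=\{x\in\mathbb{Z}^n: x\bmod m\in D\}$. The symmetric weight enumerator of $C$ is $$swe_C(x_0,x_1,\dots,x_{\lfloor m/2\rfloor})=\sum_{c\in C}x_0^{n_0(c)}x_1^{n_1(c)}\cdots x_{\lfloor m/2\rfloor}^{n_{\lfloor m/2\rfloor}(c)},$$ where $n_i(c)$ is the number of coordinates of $c$ congruent to $\pm i\pmod m$. For a lattice $\Lambda\subseteq\mathbb{R}^n$, $\Theta^1_\Lambda(q)=\sum_{x\in\Lambda}q^{\|x\|_1}$ for real $0\le q<1$, where $\|x\|_1=\sum_i|x_i|$. *)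

(* Defs.v *)
From HB Require Import structures.
From mathcomp Require Import all_boot all_order all_algebra.
From mathcomp Require Import all_classical all_reals all_analysis.

Set Implicit Arguments.
Unset Strict Implicit.
Unset Printing Implicit Defensive.

Import Order.TTheory GRing.Theory Num.Theory.

Local Open Scope classical_set_scope.
Local Open Scope ring_scope.

(* Words are row vectors over 'Z_m, which is Z/mZ only when 1 < m. *)

Definition linear_code (m n : nat) (C : {set 'rV['Z_m]_n}) : Prop :=
  [/\ 0 \in C,
      (forall x y, x \in C -> y \in C -> x + y \in C)
    & (forall (a : int) x, x \in C -> x *~ a \in C)].

Definition dual_code (m n : nat) (C : {set 'rV['Z_m]_n}) : {set 'rV['Z_m]_n} :=
  [set y : 'rV['Z_m]_n |
    [forall (x : 'rV['Z_m]_n | x \in C), \sum_i y 0 i * x 0 i == 0]]%SET.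

Definition mod_vec (m n : nat) (z : 'rV[int]_n) : 'rV['Z_m]_n :=
  map_mx (fun a : int => a%:~R) z.

(* Z^n is embedded in R^n, so that the result is a subset of R^n. *)
Definition constructionA (R : realType) (m n : nat) (D : {set 'rV['Z_m]_n}) :
    set 'rV[R]_n :=
  [set map_mx (fun a : int => a%:~R) z |
    z in [set z : 'rV[int]_n | mod_vec m z \in D]].
Arguments constructionA R {m n} D _.

Definition ncoord (m n i : nat) (c : 'rV['Z_m]_n) : nat :=
  #|[set j : 'I_n | (c 0 j == i%:R) || (c 0 j == - i%:R)]%SET|.

Definition swe (R : comNzRingType) (m n : nat) (C : {set 'rV['Z_m]_n})
    (x : 'I_(m./2).+1 -> R) : R :=
  \sum_(c in C) \prod_(i < (m./2).+1) x i ^+ ncoord i c.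

Definition norm1 (R : realType) (n : nat) (x : 'rV[R]_n) : R :=
  \sum_i `|x 0 i|.

(* The terms are nonnegative for 0 <= q, so the unordered sum always exists in
   the extended reals; the x = 0 term is 1 also at q = 0, as 0 `^ 0 = 1. *)
Definition theta1 (R : realType) (n : nat) (L : set 'rV[R]_n) (q : R) : \bar R :=
  \esum_(x in L) (q `^ norm1 x)%:E.

(* Main.v *)
(* Sorting Z^n by residues modulo m and factoring over coordinates, the theta
   series is the sum over y in the dual code of prod_i g(y_i), where g(a) is the
   sum of q^|z| over z = a mod m, namely (q^a + q^(m-a)) / (1 - q^m).  By
   MacWilliams duality this is 1/|C| times the sum over c in C of
   prod_i g^(c_i), where g^ is the Fourier transform of g on Z/mZ.  Two geometric
   sums give
     g^(k) = (1 - q^2) / ((1 - q u) (1 - q / u))  for u = exp(2 i pi k / m),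
   which is (1 - q^2) y_k; it is even in k, so the product over the coordinates
   is the monomial of c in the symmetric weight enumerator. *)
Require Import Defs.
From HB Require Import structures.
From mathcomp Require Import all_boot all_order all_algebra.
From mathcomp Require Import all_classical all_reals all_analysis.
From mathcomp Require Import complex ring lra zify.

Set Implicit Arguments.
Unset Strict Implicit.
Unset Printing Implicit Defensive.

Import Order.TTheory GRing.Theory Num.Theory.

Local Open Scope classical_set_scope.
Local Open Scope ring_scope.

(** * Powers of an m-th root of unity with exponents in ['Z_m] *)

(** A residue used as an exponent is coerced to its representative below m; as [w ^+ m = 1], any
    other representative gives the same power. *)
Lemma Zp_expr_nat (S : pzSemiRingType) (m : nat) (w : S) (k : nat) :
  (1 < m)%N -> w ^+ m = 1 -> w ^+ (k%:R : 'Z_m) = w ^+ k.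
Proof. by move=> m_gt1 wm; rewrite val_Zp_nat// expr_mod. Qed.

Lemma Zp_exprD (S : pzSemiRingType) (m : nat) (w : S) (a b : 'Z_m) :
  (1 < m)%N -> w ^+ m = 1 -> w ^+ (a + b : 'Z_m)%R = w ^+ a * w ^+ b.
Proof.
by move=> m_gt1 wm; rewrite -exprD -(Zp_expr_nat (_ + _) m_gt1 wm) natrD !natr_Zp.
Qed.

Lemma Zp_exprM (S : pzSemiRingType) (m : nat) (w : S) (a b : 'Z_m) :
  (1 < m)%N -> w ^+ m = 1 -> w ^+ (a * b : 'Z_m)%R = (w ^+ b) ^+ a.
Proof.
move=> m_gt1 wm.
by rewrite -exprM mulnC -(Zp_expr_nat (_ * _) m_gt1 wm) natrM !natr_Zp.
Qed.

Lemma Zp_expr_sum (S : comPzSemiRingType) (m : nat) (w : S) (I : finType)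
    (F : I -> 'Z_m) :
  (1 < m)%N -> w ^+ m = 1 -> w ^+ (\sum_i F i : 'Z_m)%R = \prod_i w ^+ F i.
Proof.
move=> m_gt1 wm; elim/big_rec2 : _ => [|i y1 y2 _ <-]; first by rewrite expr0.
by rewrite Zp_exprD.
Qed.

(** * Character sums over a code and MacWilliams duality *)

(** If y is not in the dual, some x in C has nonzero product b with y. Translation by x permutes C
    and multiplies the sum by [w ^+ b], which differs from 1 by primitivity, so the sum is 0 in a
    domain. *)
Lemma linear_code_expr_sum (K : idomainType) (m n : nat) (w : K)
    (C : {set 'rV['Z_m]_n}) (y : 'rV['Z_m]_n) :
    (1 < m)%N -> m.-primitive_root w -> linear_code C ->
  \sum_(c in C) w ^+ (\sum_i y 0 i * c 0 i : 'Z_m)%R =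
  if y \in dual_code C then #|C|%:R else 0.
Proof.
move=> m_gt1 pw [C0 CD CZ]; have wm := prim_expr_order pw.
case: ifPn => [|]; rewrite inE.
  move=> /forall_inP yC.
  by rewrite (eq_bigr (fun=> 1)) ?sumr_const// => c /yC/eqP->; rewrite expr0.
rewrite negb_forall_in => /exists_inP[x xC yx0].
set b : 'Z_m := \sum_i _ in yx0; set S := LHS.
have wb1 : w ^+ b != 1.
  rewrite -(prim_order_dvd pw) /dvdn modn_small; first exact: yx0.
  by rewrite -{2}[m]Zp_cast.
apply/eqP; suff : (w ^+ b - 1) * S == 0 by rewrite mulf_eq0 subr_eq0 (negbTE wb1).
rewrite mulrBl mul1r subr_eq0 {2}/S; apply/eqP.
rewrite (reindex_onto (fun c => x + c) (fun c => c - x)) => [|c _]; last first.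
  by rewrite addrC subrK.
rewrite mulr_sumr; apply: eq_big => [c|c _].
  rewrite addrAC subrr add0r eqxx andbT; apply/idP/idP => [cC|/(CD _ _ (CZ (-1) _ xC))].
    exact: CD.
  by rewrite mulrN1z addKr.
rewrite -Zp_exprD// /b -big_split/=; congr (w ^+ nat_of_ord _).
by apply: eq_bigr => i _; rewrite mxE mulrDr.
Qed.

(** Distributivity turns the right side into a sum over all words y of [\prod_i f (y 0 i)] times the
    character sum of y over C, which selects the dual code. *)
Lemma macwilliams_prod (K : idomainType) (m n : nat) (w : K)
    (C : {set 'rV['Z_m]_n}) (f : 'Z_m -> K) :
    (1 < m)%N -> m.-primitive_root w -> linear_code C ->
  #|C|%:R * \sum_(y in dual_code C) \prod_i f (y 0 i) =
  \sum_(c in C) \prod_i \sum_a f a * (w ^+ c 0 i) ^+ a.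
Proof.
move=> m_gt1 pw hC; have wm := prim_expr_order pw.
transitivity (\sum_(y : 'rV['Z_m]_n) \sum_(c in C)
    (\prod_i f (y 0 i)) * w ^+ (\sum_i y 0 i * c 0 i : 'Z_m)%R).
  rewrite mulr_sumr big_mkcond; apply: eq_bigr => y _.
  by rewrite -mulr_sumr linear_code_expr_sum//; case: ifP; rewrite ?mulr0 1?mulrC.
rewrite exchange_big; apply: eq_bigr => c _ /=.
rewrite bigA_distr_bigA (reindex (fun g : {ffun 'I_n -> 'Z_m} => \row_i g i))/=.
  apply: eq_bigr => g _; rewrite Zp_expr_sum// -big_split/=.
  by apply: eq_bigr => i _; rewrite !mxE Zp_exprM.
exists (fun y => [ffun i => y 0 i]) => [g _|y _].
  by apply/ffunP => i; rewrite ffunE mxE.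
by apply/rowP => i; rewrite mxE ffunE.
Qed.

(** * Two geometric sums at a root of unity *)

(** Since v inverts u and [v ^+ m = 1], the terms [q ^+ (m - a) * u ^+ a] are the powers of [q * v]
    with exponents 1 to m. With denominators cleared, the identity holds in any commutative ring. *)
Lemma sum_reflected_geometric (K : comNzRingType) (m : nat) (q u v : K) :
    u ^+ m = 1 -> u * v = 1 ->
  (1 - q * u) * (1 - q * v) * (\sum_(a < m) (q ^+ a + q ^+ (m - a)) * u ^+ a) =
  (1 - q ^+ m) * (1 - q ^+ 2).
Proof.
move=> um uv; have vm : v ^+ m = 1 by rewrite -[LHS]mul1r -um -exprMn uv expr1n.
have geo t : t ^+ m = 1 -> (1 - q * t) * (\sum_(a < m) (q * t) ^+ a) = 1 - q ^+ m.
  by move=> tm; rewrite -opprB mulNr -subrX1 exprMn tm mulr1 opprB.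
under eq_bigr do rewrite mulrDl -exprMn.
have rev : \sum_(a < m) q ^+ (m - a) * u ^+ a = q * v * (\sum_(a < m) (q * v) ^+ a).
  rewrite (reindex_inj rev_ord_inj) mulr_sumr /=; apply: eq_bigr => a _.
  rewrite subKn// -exprS exprMn; congr (_ * _).
  rewrite -[LHS]mulr1 -vm -[X in v ^+ X](subnK (ltn_ord a)) exprD mulrA.
  by rewrite -exprMn uv expr1n mul1r.
rewrite big_split /= rev; move: (geo u um) (geo v vm).
set A := \sum_(a < m) (q * u) ^+ a; set B := \sum_(a < m) (q * v) ^+ a => hA hB.
transitivity ((1 - q * v) * ((1 - q * u) * A)
            + (1 - q * u) * q * v * ((1 - q * v) * B)); first by ring.
have -> : q ^+ 2 = q ^+ 2 * (u * v) by rewrite uv mulr1.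
by rewrite hA hB; ring.
Qed.

(** * A primitive complex m-th root of unity *)

Lemma cos_sin_exprn (R : realType) (x : R) (k : nat) :
  (cos x +i* sin x)%C ^+ k = (cos (x * k%:R) +i* sin (x * k%:R))%C.
Proof.
elim: k => [|k IHk]; first by rewrite expr0 mulr0 cos0 sin0.
rewrite exprSr IHk -[k.+1]addn1 natrD mulrDr mulr1 cosD sinD.
by apply/eqP; rewrite eq_complex /= [X in _ && (_ == X)]addrC !eqxx.
Qed.

Lemma cos_sin_primitive (R : realType) (m : nat) : (0 < m)%N ->
  m.-primitive_root (cos (2 * pi / m%:R) +i* sin (2 * pi / m%:R) : R[i])%C.
Proof.
move=> m_gt0; have m0 : (0 : R) < m%:R by rewrite ltr0n.
apply/andP; split => //; apply/forallP => i.
rewrite unity_rootE cos_sin_exprn; case: (eqVneq i.+1 m) => [->|im].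
  by rewrite divfK ?lt0r_neq0// mulr_natl cos2pi sin2pi !eqxx.
apply/eqP/negP => /eqP-[].
(* Half the angle of the power: [cos (x *+ 2) = 1] would force [sin x = 0], whereas x lies strictly
   between 0 and pi. *)
set x : R := pi * i.+1%:R / m%:R.
rewrite (_ : 2 * pi / m%:R * i.+1%:R = x *+ 2); last first.
  by rewrite /x -mulr_natl; field; rewrite lt0r_neq0.
have x_gt0 : 0 < x by rewrite /x divr_gt0// mulr_gt0 ?pi_gt0.
have x_ltpi : x < pi.
  rewrite /x ltr_pdivrMr// ltr_pM2l ?pi_gt0// ltr_nat ltn_neqAle im.
  exact: ltn_ord.
have := @sin_gt0_pi R x; rewrite x_gt0 x_ltpi => /(_ isT) sx.
rewrite cos_mulr2n => c2 _; have := cos2Dsin2 x.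
nra.
Qed.

(** * The symmetric weight enumerator at an even function *)

(** Each residue a equals k or -k for exactly one k up to m/2, namely [minn a (m - a)]. After the
    products are exchanged, every coordinate therefore keeps a single factor. *)
Lemma swe_even (S : comNzRingType) (m n : nat) (C : {set 'rV['Z_m]_n})
    (F : 'Z_m -> S) :
    (1 < m)%N -> (forall a, F (- a) = F a) ->
  swe C (fun k => F k%:R) = \sum_(c in C) \prod_j F (c 0 j).
Proof.
move=> m_gt1 FN; apply: eq_bigr => c _.
pose e (k : nat) j := (c 0 j == k%:R) || (c 0 j == - k%:R).
transitivity (\prod_(k < m./2.+1) \prod_j if e k j then F (c 0 j) else 1).
  apply: eq_bigr => k _; rewrite -big_mkcond /=.
  rewrite (eq_bigr (fun=> F k%:R)) => [|j /orP[] /eqP->//].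
  by rewrite prodr_const /ncoord cardsE.
rewrite exchange_big; apply: eq_bigr => j _ /=; rewrite -big_mkcond /=.
set a := c 0 j; rewrite /e -/a; have am : (a < m)%N by rewrite -{2}[m]Zp_cast.
have ek (k : nat) : (k <= m./2)%N ->
    (a == k%:R) || (a == - k%:R) = (k == minn a (m - a)).
  move=> km; have km' : (k < m)%N by lia.
  have -> : (a == k%:R) = (a == k :> nat).
    by rewrite -(inj_eq val_inj) /= val_Zp_nat// modn_small.
  have -> : (a == - k%:R) = ((a + k) %% m == 0)%N.
    rewrite -subr_eq0 opprK -{1}[a]natr_Zp -natrD -(inj_eq val_inj) /=.
    by rewrite val_Zp_nat.
  (* For positive k, a + k lies strictly between 0 and 2m, so it vanishes modulo m only when it
     equals m. *)
  have [->|k0] := posnP k; first by rewrite addn0 modn_small//; lia.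
  have [ak|ak] := ltnP (a + k) m; first by rewrite modn_small//; lia.
  rewrite -[(a + k)%N](subnK ak) modnDr modn_small; last by lia.
  by lia.
have kP : (minn a (m - a) < m./2.+1)%N by lia.
rewrite (big_pred1 (Ordinal kP)) // => k.
rewrite -[RHS]val_eqE; exact: ek (leq_ord k).
Qed.

(** * Unordered sums of nonnegative terms *)

Lemma esumZl (R : realType) (T : choiceType) (I : set T) (c : R) (a : T -> R) :
  0 <= c ->
  \esum_(i in I) (c * a i)%:E = (c%:E * \esum_(i in I) (a i)%:E)%E.
Proof.
move=> c0; rewrite /esum -ereal_supZl//; last first.
  by apply/set0P; exists (\sum_(i \in set0) (a i)%:E)%E, set0; first exact: fsets_set0.
congr ereal_sup; rewrite image_comp; apply: eq_imagel => A [finA _] /=.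
by rewrite !fsbig_finite//= !sumEFin -EFinM mulr_sumr.
Qed.

Lemma esum_geometric (R : realType) (c x : R) : 0 <= c -> 0 <= x < 1 ->
  \esum_(k in [set: nat]) (c * x ^+ k)%:E = (c / (1 - x))%:E.
Proof.
move=> c0 /andP[x0 x1].
rewrite -nneseries_esumT => [|k]; last by rewrite lee_fin mulr_ge0// exprn_ge0.
apply/cvg_lim => //; rewrite (_ : (fun _ => _) = EFin \o series (geometric c x)).
  apply: cvg_EFin; first by apply: nearW.
  by apply: cvg_geometric_series; rewrite ger0_norm.
by apply/funext => k; rewrite /series/= sumEFin.
Qed.

Lemma esum_setX_EFin (R : realType) (T1 T2 : choiceType) (I : set T1)
    (J : set T2) (a : T1 -> R) (b : T2 -> R) (B : R) :
    (forall i, 0 <= a i) -> (forall j, 0 <= b j) ->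
    \esum_(j in J) (b j)%:E = B%:E ->
  \esum_(k in I `*` J) (a k.1 * b k.2)%:E = ((\esum_(i in I) (a i)%:E) * B%:E)%E.
Proof.
move=> a0 b0 hB; have B0 : 0 <= B.
  by rewrite -lee_fin -hB; apply: esum_ge0 => j _; rewrite lee_fin.
rewrite muleC -esumZl//.
rewrite -(esum_esum (J := fun=> J) (a := fun i j => (a i * b j)%:E)); last first.
  by move=> i j _ _; rewrite lee_fin mulr_ge0.
by apply: eq_esum => i _; rewrite esumZl// hB -EFinM mulrC.
Qed.

(** Induction on n: a row splits into its first entry and its tail, and the sum over the resulting
    product set factors. *)
Lemma esum_row_prod (R : realType) (T : nmodType) (n : nat)
    (P : 'I_n -> set T) (f : T -> R) (g : 'I_n -> R) :
    (forall t, 0 <= f t) ->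
    (forall i, \esum_(t in P i) (f t)%:E = (g i)%:E) ->
  \esum_(z in [set z : 'rV[T]_n | forall i, P i (z 0 i)])
     (\prod_i f (z 0 i))%:E = (\prod_i g i)%:E.
Proof.
move=> f0; elim: n P g => [|n IHn] P g Pg.
  rewrite (_ : mkset _ = [set 0]); last first.
    by apply/seteqP; split => z _; [apply/rowP; case|case].
  by rewrite esum_set1 !big_ord0// lee_fin.
pose J := [set z : 'rV[T]_n | forall i, P (lift ord0 i) (z 0 i)].
(* Prepends an entry to a row; this is the bijection used to reindex the sum. *)
pose e (tz : T * 'rV[T]_n) : 'rV[T]_n.+1 :=
  \row_i if unlift ord0 i is Some j then tz.2 0 j else tz.1.
have e0 tz : e tz 0 ord0 = tz.1 by rewrite mxE unlift_none.
have eS tz i : e tz 0 (lift ord0 i) = tz.2 0 i by rewrite mxE liftK.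
rewrite (reindex_esum (P ord0 `*` J) _ e); last first.
  split=> [tz [/= Pt Jz] i|[t z] [t' z'] _ _ ee|z Pz].
  - by case: (unliftP ord0 i) => [j|] ->; rewrite ?e0 ?eS//; exact: Jz.
  - congr (_, _); first by have := e0 (t, z); rewrite ee e0.
    by apply/rowP => j; have := eS (t, z) j; rewrite ee eS.
  - exists (z 0 ord0, \row_j z 0 (lift ord0 j)).
      by split=> [|j]; rewrite /= ?mxE; exact: Pz.
    by apply/rowP => i; case: (unliftP ord0 i) => [j|] ->; rewrite ?e0 ?eS//= mxE.
under eq_esum do rewrite big_ord_recl e0.
under eq_esum do under eq_bigr do rewrite eS.
have prod0 (z : 'rV[T]_n) : 0 <= \prod_i f (z 0 i) by exact: prodr_ge0.
have IH := IHn _ _ (fun i => Pg (lift ord0 i)).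
by rewrite (esum_setX_EFin (P ord0) f0 prod0 IH) Pg big_ord_recl EFinM.
Qed.

(** * The theta series of a Construction A lattice *)

(** Closed form of the sum of [q ^+ |z|] over the integers z congruent to a, with a read as its
    representative below m. *)
Definition residue_sum (R : realType) (m : nat) (q : R) (a : 'Z_m) : R :=
  (q ^+ a + q ^+ (m - a)) / (1 - q ^+ m).

(** The nonnegative members of the class are a + km and the negative ones -(m - a + km), for natural
    k; each family gives a geometric series of ratio [q ^+ m]. *)
Lemma esum_residue (R : realType) (m : nat) (q : R) (a : 'Z_m) :
    (1 < m)%N -> 0 <= q < 1 ->
  \esum_(z in [set z : int | z%:~R = a]) (q ^+ `|z|)%:E = (residue_sum q a)%:E.
Proof.
move=> m_gt1 /andP[q0 q1]; have m_gt0 : (0 < m)%N by exact: ltnW.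
have am : (a < m)%N by rewrite -{2}[m]Zp_cast.
have qm : 0 <= q ^+ m < 1 by rewrite exprn_ge0// exprn_ilt1// -lt0n.
have natE p : (p%:R = a) <-> (p %% m = a)%N.
  by rewrite -(val_Zp_nat m_gt1 p); split=> [->|/val_inj].
have negE p : (- p%:R = a) <-> ((p + a) %% m = 0)%N.
  rewrite -(val_Zp_nat m_gt1) natrD natr_Zp.
  split=> [<-|/(@val_inj _ _ _ (p%:R + a) 0)/eqP]; first by rewrite subrr.
  by rewrite addr_eq0 => /eqP->; rewrite opprK.
rewrite (esumID [set z : int | 0 <= z])/=; last first.
  by move=> z _; rewrite lee_fin exprn_ge0.
rewrite (reindex_esum setT _ (fun k : nat => Posz (a + k * m))); last first.
  split=> [k _|k k' _ _ []|z [/= za z0]].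
  - by split => //=; apply/natE; rewrite addnC modnMDl modn_small.
  - by move=> /addnI/eqP; rewrite eqn_pmul2r// => /eqP.
  - case: z za z0 => // p /natE <- _; exists (p %/ m)%N => //.
    by rewrite addnC -divn_eq.
(* [Negz p] stands for -(p + 1), hence the predecessor; m - a is positive because a < m. *)
rewrite [X in (_ + X)%E](reindex_esum setT _
  (fun k : nat => Negz (m - a + k * m).-1)); last first.
  split=> [k _|k k' _ _ []|z [/= za /negP z0]].
  - split => //=; rewrite NegzE prednK ?addn_gt0 ?subn_gt0 ?am// mulrNz.
    by apply/negE; rewrite addnAC subnK ?(ltnW am)// -mulSn modnMl.
  - move=> kk'; have /addnI/eqP : (m - a + k * m = m - a + k' * m)%N by lia.
    by rewrite eqn_pmul2r// => /eqP.
  - case: z za z0 => // p; rewrite NegzE mulrNz => /negE pa _.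
    exists ((p.+1 + a) %/ m).-1 => //; congr Negz.
    have := divn_eq (p.+1 + a) m; rewrite pa addn0.
    by case: (_ %/ m)%N => [|d]; rewrite ?mulSn /=; lia.
under eq_esum do rewrite /= exprD mulnC exprM.
under [X in (_ + X)%E]eq_esum => k _.
  rewrite NegzE abszN absz_nat prednK ?addn_gt0 ?subn_gt0 ?am// exprD mulnC exprM.
  over.
have geo k := esum_geometric (exprn_ge0 k q0) qm.
by rewrite !geo -EFinD /residue_sum mulrDl.
Qed.

Lemma theta1_constructionA (R : realType) (m n : nat) (D : {set 'rV['Z_m]_n})
    (q : R) : (1 < m)%N -> 0 <= q < 1 ->
  theta1 (constructionA R D) q =
  (\sum_(y in D) \prod_i residue_sum q (y 0 i))%:E.
Proof.
move=> m_gt1 q01; have /andP[q0 _] := q01.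
rewrite /theta1 /constructionA esum_image; last first.
  move=> z z' _ _ /matrixP zz'; apply/matrixP => i j.
  by have := zz' i j; rewrite !mxE => /intr_inj.
(* Membership in the lattice becomes a finite sum of indicators with at most one nonzero term, so
   that the two sums can be exchanged. *)
transitivity (\esum_(z in [set: 'rV[int]_n]) \sum_(y in D)
    if mod_vec m z == y then (\prod_i q ^+ `|z 0 i|)%:E else 0%E)%E.
  rewrite esum_mkcond; apply: eq_esum => z _; rewrite -big_mkcondr/=.
  rewrite (_ : (z \in _) = (mod_vec m z \in D)); last first.
    by apply/idP/idP; rewrite inE.
  have normE : norm1 (map_mx (fun a : int => a%:~R) z : 'rV[R]_n) =
      (\sum_i `|z ord0 i|)%N%:R.
    by rewrite natr_sum; apply: eq_bigr => i _; rewrite mxE -intr_norm natr_absz.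
  rewrite normE powR_mulrn// expr_sum; case: ifPn => zD.
    rewrite (big_pred1 (mod_vec m z))// => y.
    by rewrite /= (eq_sym y); case: eqVneq => [<-|]; rewrite ?zD ?andbF.
  rewrite big_pred0// => y; apply/negP => /andP[yD /eqP zy].
  by rewrite zy yD in zD.
rewrite esum_sum => [|z y _ _]; last first.
  by case: ifP => // _; rewrite lee_fin prodr_ge0// => i _; rewrite exprn_ge0.
rewrite -sumEFin; apply: eq_bigr => y _.
rewrite -(esum_row_prod (P := fun i => [set z : int | z%:~R = y 0 i])
  (f := fun z : int => q ^+ `|z|)).
- rewrite [RHS]esum_mkcond; apply: eq_esum => z _; congr (if _ then _ else _).
  apply/eqP/idP => [<-|/set_mem/= zy].
    by apply/mem_set => i /=; rewrite mxE.
  by apply/rowP => i; rewrite mxE.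
- by move=> z; rewrite exprn_ge0.
- by move=> i; exact: esum_residue.
Qed.

(** * The Fourier transform of the residue sums *)

Lemma sum_residue_sum (R : realType) (m : nat) (q : R) (c : 'Z_m) :
    (1 < m)%N -> 0 <= q < 1 ->
  let w := (cos (2 * pi / m%:R) +i* sin (2 * pi / m%:R))%C in
  \sum_(a : 'Z_m) (residue_sum q a)%:C%C * (w ^+ c) ^+ a =
  ((1 - q ^+ 2) / (q ^+ 2 - 2 * q * cos (2 * pi * c%:R / m%:R) + 1))%:C%C.
Proof.
move=> m_gt1 /andP[q0 q1] w; have m_gt0 : (0 < m)%N by exact: ltnW.
have m0 : m%:R != 0 :> R by rewrite pnatr_eq0 -lt0n.
set x : R := 2 * pi * c%:R / m%:R.
have wc : w ^+ c = (cos x +i* sin x)%C.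
  by rewrite cos_sin_exprn (_ : _ * c%:R = x)// /x; field.
have wcm : (w ^+ c) ^+ m = 1.
  by rewrite exprAC (prim_expr_order (cos_sin_primitive R m_gt0)) expr1n.
pose v : R[i] := (cos x -i* sin x)%C.
have uv : w ^+ c * v = 1.
  rewrite wc; apply/eqP; rewrite eq_complex /= mulrN opprK -!expr2 cos2Dsin2.
  by rewrite eqxx/= mulrN mulrC addNr.
have qm0 : 1 - q ^+ m != 0.
  by rewrite subr_eq0 eq_sym lt_eqF// exprn_ilt1// -lt0n.
(* The denominator is [(1 - q) ^+ 2 + 2 * q * (1 - cos x)], which is positive. *)
have den : q ^+ 2 - 2 * q * cos x + 1 != 0.
  have : 0 <= q * (1 - cos x) by rewrite mulr_ge0// subr_ge0 cos_le1.
  have : 0 < (1 - q) ^+ 2 by rewrite exprn_gt0// subr_gt0.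
  move: (cos x) => k h1 h2; apply: lt0r_neq0; nra.
have denE : (1 - q%:C%C * w ^+ c) * (1 - q%:C%C * v) =
    (q ^+ 2 - 2 * q * cos x + 1)%:C%C.
  rewrite wc; apply/eqP; rewrite eq_complex /=; have := cos2Dsin2 x.
  by move=> cs; apply/andP; split; apply/eqP; nra.
have := sum_reflected_geometric q%:C%C wcm uv; rewrite denE.
move: (w ^+ c) => u key.
transitivity ((\sum_(a < m) (q%:C%C ^+ a + q%:C%C ^+ (m - a)) * u ^+ a)
              / (1 - q ^+ m)%:C%C).
  (* The index type ['Z_m] has bound [(Zp_trunc m).+2], which equals m only through [Zp_cast]. *)
  have toZp (G : nat -> R[i]) : \sum_(a < m) G a = \sum_(a : 'Z_m) G a.
    by rewrite -!(big_mkord xpredT) Zp_cast.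
  rewrite mulr_suml (toZp (fun a => (q%:C%C ^+ a + q%:C%C ^+ (m - a)) * u ^+ a / _)).
  apply: eq_bigr => a _.
  by rewrite /residue_sum -!rmorphXn -rmorphD mulrAC fmorph_div.
rewrite fmorph_div; apply/eqP.
have inj0 y : y != 0 -> y%:C%C != 0 :> R[i] by rewrite fmorph_eq0.
by rewrite eqr_div ?inj0// mulrC key mulrC !rmorphB !rmorphXn rmorph1.
Qed.

(** * Assembly of the identity *)

Theorem proposition2 (R : realType) (m n : nat) (hm : (2 <= m)%N)
    (C : {set 'rV['Z_m]_n}) (hC : linear_code C)
    (q : R) (hq0 : 0 <= q) (hq1 : q < 1) :
  theta1 (constructionA R (dual_code C)) q =
  ((1 - q ^+ 2) ^+ n / #|C|%:R *
   swe C (fun k : 'I_(m./2).+1 =>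
     1 / (q ^+ 2 - 2 * q * cos (2 * pi * k%:R / m%:R) + 1)))%:E.
Proof.
have m_gt0 : (0 < m)%N by exact: ltnW.
have m0 : m%:R != 0 :> R by rewrite pnatr_eq0 -lt0n.
have q01 : 0 <= q < 1 by rewrite hq0.
have C_gt0 : (0 < #|C|)%N by apply/card_gt0P; exists 0; case: hC.
have C0 : #|C|%:R != 0 :> R by rewrite pnatr_eq0 -lt0n.
(* Extends y_k from the indices up to m/2 to all residues; evenness comes from the symmetry of the
   cosine under x to 2 pi - x. *)
pose F (a : 'Z_m) : R := 1 / (q ^+ 2 - 2 * q * cos (2 * pi * a%:R / m%:R) + 1).
have FN a : F (- a) = F a.
  (* Zero is set apart because -a has representative m - a only for nonzero a. *)
  have [->|a0] := eqVneq a 0; first by rewrite oppr0.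
  have am : (a < m)%N by rewrite -{2}[m]Zp_cast.
  have aN : (- a : 'Z_m) = (m - a)%N :> nat.
    have mZ : m%:R = 0 :> 'Z_m by apply: val_inj; rewrite /= val_Zp_nat// modnn.
    have -> : - a = (m - a)%:R by rewrite natrB ?(ltnW am)// mZ natr_Zp sub0r.
    by rewrite val_Zp_nat// modn_small// ltn_subrL m_gt0 andbT lt0n.
  rewrite /F aN natrB ?(ltnW am)//; congr (1 / (_ - _ * _ + 1)).
  rewrite (_ : _ / _ = pi *+ 2 - 2 * pi * a%:R / m%:R); last first.
    by rewrite -mulr_natl; field.
  by rewrite cosB cos2pi sin2pi mul1r mul0r addr0.
rewrite theta1_constructionA//; congr EFin.
have -> : swe C (fun k : 'I_(m./2).+1 =>
     1 / (q ^+ 2 - 2 * q * cos (2 * pi * k%:R / m%:R) + 1)) =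
   \sum_(c in C) \prod_j F (c 0 j).
  rewrite -swe_even//; apply: eq_bigr => c _; apply: eq_bigr => k _.
  rewrite /F val_Zp_nat// modn_small//.
  have := ltn_ord k; lia.
(* Clearing [#|C|] and embedding R into [R[i]], where the root of unity lives, brings the goal to
   the form of the duality identity. *)
apply: (mulfI C0).
rewrite [RHS](_ : _ = (1 - q ^+ 2) ^+ n * \sum_(c in C) \prod_j F (c 0 j));
  last by field.
apply: (@complexI R).
have := macwilliams_prod (fun a => (residue_sum q a)%:C%C) hm
  (cos_sin_primitive R m_gt0) hC.
rewrite [X in _ = X -> _](eq_bigr (fun c : 'rV['Z_m]_n =>
  ((1 - q ^+ 2) ^+ n * \prod_j F (c 0 j))%:C%C)).
  rewrite -rmorph_sum -mulr_sumr => <-.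
  rewrite rmorphM rmorph_nat rmorph_sum; congr (_ * _).
  by apply: eq_bigr => y _; rewrite rmorph_prod.
move=> c _; rewrite (eq_bigr (fun j => ((1 - q ^+ 2) * F (c 0 j))%:C%C)).
  by rewrite -rmorph_prod big_split/= prodr_const card_ord.
by move=> j _; rewrite sum_residue_sum// /F mul1r.
Qed.
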